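(* Let $n\in\mathbb{N}$, $q\in\{2,3,\dots\}$, $\delta\in(0,1/q)$, $I^n=[-1,1]^n$, and let $D\subset\delta I^n$ be an origin-symmetric convex body. Then $$|D|\,q^n\le W_n(D).$$
   Context: $\mathbb{T}^n=\mathbb{R}^n/\mathbb{Z}^n$, identified with $[-1/2,1/2)^n$ and equipped with Lebesgue measure; $|D|$ is the volume of $D$. For $f\in L^1(\mathbb{T}^n)$ (complex-valued), $\widehat f_\nu=\int_{\mathbb{T}^n}f(x)e^{-2\pi i\nu x}\,dx$, $\nu\in\mathbb{Z}^n$. $L^1_+(\mathbb{T}^n)=\{f\in L^1(\mathbb{T}^n):\widehat f_\nu\ge 0\text{ for all }\nu\in\mathbb{Z}^n\}$. For an origin-symmetric convex body $D\subset\mathbb{T}^n$ (i.e. $D\subset[-1/2,1/2)^n$), the sharp Wiener constant is $$W_n(D)=\sup_{f\in L^1_+(\mathbb{T}^n)\setminus\{0\}}\frac{\int_{\mathbb{T}^n}|f|^2\,dx}{|D|^{-1}\int_D|f|^2\,dx},$$ where functions with $\int_D|f|^2\,dx=\infty$ are disregarded and $c/0=+\infty$ for $c>0$; that is, $W_n(D)$ is the smallest constant $W$ with $\int_{\mathbb{T}^n}|f|^2\,dx\le W|D|^{-1}\int_D|f|^2\,dx$ for all $f\in L^1_+(\mathbb{T}^n)$. *)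

(* Defs.v *)
From HB Require Import structures.
From mathcomp Require Import all_boot all_order all_algebra.
From mathcomp Require Import all_classical all_reals all_analysis.
From mathcomp Require Import complex.

Set Implicit Arguments.
Unset Strict Implicit.
Unset Printing Implicit Defensive.

Import Order.TTheory GRing.Theory Num.Theory.
Import numFieldNormedType.Exports.

Local Open Scope classical_set_scope.
Local Open Scope ring_scope.

(* The product (= Borel) sigma-algebra on R^n, following the library's
   construction for n.-tuple T. *)
Section measurable_rV.
Context {R : realType} (n : nat).

Let coors : 'I_n -> 'rV[R]_n -> R := fun i x => x 0 i.

Let rV_set0 : g_sigma_preimage coors set0.
Proof. exact: sigma_algebra0. Qed.

Let rV_setC A : g_sigma_preimage coors A -> g_sigma_preimage coors (~` A).
Proof. exact: sigma_algebraC. Qed.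

Let rV_bigcup (F : nat -> set 'rV[R]_n) :
  (forall i, g_sigma_preimage coors (F i)) ->
  g_sigma_preimage coors (\bigcup_i (F i)).
Proof. exact: sigma_algebra_bigcup. Qed.

HB.instance Definition _ := @isMeasurable.Build default_measure_display
  'rV[R]_n (g_sigma_preimage coors) rV_set0 rV_setC rV_bigcup.

End measurable_rV.

Section measurable_rV_lemmas.
Context {R : realType}.

Lemma measurable_coord n (i : 'I_n) :
  measurable_fun [set: 'rV[R]_n] (fun x : 'rV[R]_n => x 0 i).
Proof.
move=> _ Y mY; rewrite setTI; apply: sub_sigma_algebra => /=.
rewrite -bigcup_seq/=; exists i => /=; first by rewrite mem_index_enum.
by exists Y => //; rewrite setTI.
Qed.

Lemma measurable_fun_coordP d (T : measurableType d) n (f : T -> 'rV[R]_n) :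
  (forall i, measurable_fun [set: T] (fun t => f t 0 i)) ->
  measurable_fun [set: T] f.
Proof.
move=> mf; pose S := [set A : set 'rV[R]_n | measurable (f @^-1` A)].
suff mS : @measurable _ 'rV[R]_n `<=` S by move=> _ A /mS; rewrite setTI.
apply: smallest_sub.
  split; rewrite /S /=.
  - by rewrite preimage_set0.
  - by move=> A mA; rewrite setTD preimage_setC; exact: measurableC.
  - by move=> F mF; rewrite preimage_bigcup; exact: bigcup_measurable.
rewrite -bigcup_seq/= => _ [i _ [B mB <-]]; rewrite /S /= setTI.
by rewrite -[X in measurable X]setTI; exact: (mf i).
Qed.

Definition rV_cons n (p : R * 'rV[R]_n) : 'rV[R]_n.+1 :=
  row_mx (p.1%:M : 'rV[R]_1) p.2.

Definition rV_uncons n (v : 'rV[R]_n.+1) : R * 'rV[R]_n :=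
  (v 0 0, \row_j v 0 (lift ord0 j)).

Lemma rV_cons0 n (p : R * 'rV[R]_n) : rV_cons p 0 0 = p.1.
Proof.
have e : ord0 = lshift n (ord0 : 'I_1) by exact/val_inj.
rewrite [LHS](congr1 (rV_cons p 0) e).
by apply: etrans (row_mxEl _ p.2 _ _) _; rewrite mxE eqxx.
Qed.

Lemma rV_consS n (p : R * 'rV[R]_n) (j : 'I_n) :
  rV_cons p 0 (lift ord0 j) = p.2 0 j.
Proof.
have e : lift ord0 j = rshift 1 j by exact/val_inj.
rewrite [LHS](congr1 (rV_cons p 0) e).
exact: row_mxEr (p.1%:M : 'rV[R]_1) _ _ _.
Qed.

Lemma rV_consK n : cancel (@rV_cons n) (@rV_uncons n).
Proof.
move=> [x v]; rewrite /rV_uncons rV_cons0; congr (_, _).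
by apply/rowP => j; rewrite mxE rV_consS.
Qed.

Lemma measurable_rV_cons n : measurable_fun [set: R * 'rV[R]_n] (@rV_cons n).
Proof.
apply: measurable_fun_coordP => i; case: (unliftP ord0 i) => [j|] ->.
  under eq_fun do rewrite rV_consS.
  apply: (@measurableT_comp _ _ _ _ _ _ (fun v : 'rV[R]_n => v 0 j)) => //.
  exact: measurable_coord.
under eq_fun do rewrite rV_cons0.
exact: measurable_fst.
Qed.

Lemma measurable_rV_uncons n :
  measurable_fun [set: 'rV[R]_n.+1] (@rV_uncons n).
Proof.
apply: measurable_fun_pair; first exact: measurable_coord.
apply: measurable_fun_coordP => i; under eq_fun do rewrite mxE.
exact: measurable_coord.
Qed.

End measurable_rV_lemmas.


Section lebesgue_rV.
Context {R : realType}.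

Section step.
Variables (n : nat) (mu : {sigma_finite_measure set 'rV[R]_n -> \bar R}).

Definition lebesgue_rV_step : set 'rV[R]_n.+1 -> \bar R :=
  pushforward (@lebesgue_measure R \x mu)%E (@rV_cons R n).

Let step0 : lebesgue_rV_step set0 = 0%E.
Proof. by rewrite /lebesgue_rV_step /pushforward preimage_set0 measure0. Qed.

Let step_ge0 A : (0 <= lebesgue_rV_step A)%E.
Proof. by rewrite /lebesgue_rV_step /pushforward; exact: measure_ge0. Qed.

Let step_sigma_additive : semi_sigma_additive lebesgue_rV_step.
Proof.
by apply: measure_semi_sigma_additive; exact: measurable_rV_cons.
Qed.

HB.instance Definition _ := isMeasure.Build _ _ _ lebesgue_rV_step
  step0 step_ge0 step_sigma_additive.

Let step_sigma_finite : sigma_finite setT lebesgue_rV_step.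
Proof.
have /sigma_finiteP[F [TF ndF Foo]] := sigma_finiteT (@lebesgue_measure R).
have /sigma_finiteP[G [TG ndG Goo]] := sigma_finiteT mu.
exists (fun k => @rV_uncons R n @^-1` (F k `*` G k)).
  rewrite -preimage_bigcup (_ : \bigcup_k _ = setT) ?preimage_setT//.
  apply/seteqP; split=> // -[x y] _.
  have [i _ Fx] : (\bigcup_i F i) x by rewrite -TF.
  have [j _ Gy] : (\bigcup_i G i) y by rewrite -TG.
  exists (maxn i j) => //; split.
    by move: x Fx; exact/subsetPset/ndF/leq_maxl.
  by move: y Gy; exact/subsetPset/ndG/leq_maxr.
move=> k; have [mF Fk] := Foo k; have [mG Gk] := Goo k; split.
  rewrite -[X in measurable X]setTI; apply: measurable_rV_uncons => //.
  exact: measurableX.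
rewrite /lebesgue_rV_step /pushforward -comp_preimage.
rewrite (_ : _ \o _ = id); last by apply/funext; exact: rV_consK.
by rewrite preimage_id product_measure1E// lte_mul_pinfty// ge0_fin_numE.
Qed.

HB.instance Definition _ := Measure_isSigmaFinite.Build _ _ _ lebesgue_rV_step
  step_sigma_finite.
End step.

(* Lebesgue measure on R^n: the n-fold product of lebesgue_measure, as the
   library has binary products only. *)
Fixpoint lebesgue_rV n : {sigma_finite_measure set 'rV[R]_n -> \bar R} :=
  if n is m.+1 then lebesgue_rV_step (lebesgue_rV m) else \d_(0 : 'rV[R]_0).
End lebesgue_rV.

Section wiener.
Context {R : realType} (n : nat).
Local Notation mu := (lebesgue_rV n : {sigma_finite_measure set 'rV[R]_n -> \bar R}).
Implicit Types (D : set 'rV[R]_n) (f : 'rV[R]_n -> R[i]).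

(* The torus R^n / Z^n is represented by its fundamental domain: a function on
   the torus is an f : 'rV[R]_n -> R[i] of which only the values on torus
   matter. *)
Definition torus : set 'rV[R]_n :=
  [set x | forall i, - 2^-1 <= x 0 i < 2^-1].

Definition integrableC D f : Prop :=
  mu.-integrable D (fun x => (complex.Re (f x))%:E) /\
  mu.-integrable D (fun x => (complex.Im (f x))%:E).

Definition integralC D f : R[i] :=
  Complex (\int[mu]_(x in D) complex.Re (f x))
          (\int[mu]_(x in D) complex.Im (f x)).

Definition expi (t : R) : R[i] := Complex (cos t) (sin t).

Definition fourier f (nu : 'rV[int]_n) : R[i] :=
  integralC torus
    (fun x => f x * expi (- (2 * pi * \sum_i (nu 0 i)%:~R * x 0 i))).

(* The order on R[i] is partial: 0 <= z means that z is real and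
   nonnegative. *)
Definition L1plus : set ('rV[R]_n -> R[i]) :=
  [set f | integrableC torus f /\ forall nu, 0 <= fourier f nu].

Definition normL2sq D f : \bar R :=
  \int[mu]_(x in D) ((ComplexField.Normc.normc (f x)) ^+ 2)%:E.

(* In \bar R, 0^-1 = +oo. *)
Definition wiener D : \bar R :=
  ereal_sup [set (normL2sq torus f / ((mu D)^-1 * normL2sq D f))%E |
    f in [set f | [/\ L1plus f,
                      ~ {ae mu, forall x, torus x -> f x = 0} &
                      (normL2sq D f < +oo)%E]]].

Definition symmetric_convex_body D : Prop :=
  [/\ convex_set (D : set (convex_lmodType 'rV[R]_n)), compact D,
      D° !=set0 & forall x, D x -> D (- x)].

End wiener.

(* Main.v *)
Require Import Defs.
From mathcomp Require Import all_boot all_order all_algebra.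
From mathcomp Require Import all_classical all_reals all_analysis.
From mathcomp Require Import measurable_realfun complex ring lra.
Import Order.TTheory GRing.Theory Num.Theory.
Import numFieldNormedType.Exports.
Local Open Scope classical_set_scope.
Local Open Scope ring_scope.

(** The lower bound comes from a test function that piles up near the points of
    the grid ((1/q) Z)^n.  The torus contains q^n such points, while the cube
    [-d, d)^n, for d < 1/q, contains only the origin.  If f has equal peaks at
    all grid points and is negligible elsewhere, the cube, and hence D, sees at
    most the fraction q^-n of the square of the L2 norm of f, so that the
    quotient defining W_n(D) is at least about |D| q^n.

    The peaks are made by the trigonometric polynomials
    h(t) = (2 + 2 cos (2 pi q t))^N, and f is the product of the h(x_i).
    - Expanding 2 + 2 cos th = 1 + 1 + e^(i th) + e^(-i th), the power is a sum
      of characters e^(i k th) with coefficient 1 (cos_power_expi).  Integrating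
      characters over a symmetric interval (cintegral_expi), every Fourier
      coefficient of h is a natural number (cintegral_spikes_char_ge0), and the
      central period [-1/(2q), 1/(2q)) carries exactly 1/q of the integral of h
      (Rintegral_spikes_period).
    - Between the central period and the boundary of [-d, d), the base
      2 + 2 cos (2 pi q t) is bounded by a constant smaller than its minimum
      near 0 (spikes_separation), so raising it to a large power makes this
      part as small as desired with respect to the whole integral
      (spikes_concentrate).
    - Fubini's theorem turns integrals of products over cubes into products of
      integrals (cintegral_box), which gives both the Fourier coefficients and
      the L2 norms of f (spike_array_L1plus, normL2sq_spike_array).

    This yields |D| / (1/q + eps)^n <= W_n(D) for every eps > 0
    (wiener_ge_approx), and the theorem follows as eps tends to 0. *)

Set Implicit Arguments.
Unset Strict Implicit.

(** * Complex-valued integrals and tensor products *)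

Lemma integrable_tensor (R : realType) (d1 d2 : measure_display)
    (T1 : measurableType d1) (T2 : measurableType d2)
    (m1 : {sigma_finite_measure set T1 -> \bar R})
    (m2 : {sigma_finite_measure set T2 -> \bar R}) (f : T1 -> R) (g : T2 -> R) :
  m1.-integrable setT (EFin \o f) -> m2.-integrable setT (EFin \o g) ->
  (m1 \x m2)%E.-integrable setT (EFin \o (fun z => f z.1 * g z.2)).
Proof.
move=> fi gi; have /integrableP[/measurable_EFinP mf foo] := fi.
have /integrableP[/measurable_EFinP mg goo] := gi.
apply/integrable12ltyP.
  apply/measurable_EFinP/measurable_funM.
    exact: (measurableT_comp mf measurable_fst).
  exact: (measurableT_comp mg measurable_snd).
under eq_integral => x _.
  under eq_integral => y _ do rewrite /= normrM EFinM.
  rewrite ge0_integralZl//=; last by do 2! apply: measurableT_comp.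
  over.
rewrite /= ge0_integralZr//=; last 2 first.
- by do 2! apply: measurableT_comp.
- exact: integral_ge0.
by rewrite lte_mul_pinfty// ?integral_ge0// ge0_fin_numE// integral_ge0.
Qed.

Lemma Rintegral_tensor (R : realType) (d1 d2 : measure_display)
    (T1 : measurableType d1) (T2 : measurableType d2)
    (m1 : {sigma_finite_measure set T1 -> \bar R})
    (m2 : {sigma_finite_measure set T2 -> \bar R}) (f : T1 -> R) (g : T2 -> R) :
  m1.-integrable setT (EFin \o f) -> m2.-integrable setT (EFin \o g) ->
  \int[(m1 \x m2)%E]_z (f z.1 * g z.2) =
  (\int[m1]_x f x) * (\int[m2]_y g y).
Proof.
move=> fi gi; rewrite {1}/Rintegral.
rewrite -(integral12_prod_meas1 (integrable_tensor fi gi)).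
rewrite /fubini_F /=.
have gE : (\int[m2]_y (g y)%:E)%E = (\int[m2]_y g y)%:E.
  by rewrite /Rintegral fineK//; exact: integrable_fin_num.
under eq_integral => x _.
  under eq_integral => y _ do rewrite EFinM.
  rewrite integralZl// gE -EFinM. over.
by rewrite -RintegralZr.
Qed.

Definition cintegrable (R : realType) (d : measure_display)
    (T : measurableType d) (mu : set T -> \bar R) (D : set T) (f : T -> R[i]) :=
  mu.-integrable D (EFin \o (fun x => complex.Re (f x))) /\
  mu.-integrable D (EFin \o (fun x => complex.Im (f x))).

Definition cintegral (R : realType) (d : measure_display)
    (T : measurableType d) (mu : {measure set T -> \bar R}) (D : set T)
    (f : T -> R[i]) : R[i] :=
  Complex (\int[mu]_(x in D) complex.Re (f x))
          (\int[mu]_(x in D) complex.Im (f x)).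

Lemma cintegrable_tensor (R : realType) (d1 d2 : measure_display)
    (T1 : measurableType d1) (T2 : measurableType d2)
    (m1 : {sigma_finite_measure set T1 -> \bar R})
    (m2 : {sigma_finite_measure set T2 -> \bar R})
    (f : T1 -> R[i]) (g : T2 -> R[i]) :
  cintegrable m1 setT f -> cintegrable m2 setT g ->
  cintegrable (m1 \x m2)%E setT (fun z => f z.1 * g z.2).
Proof.
move=> [fr fi] [gr gi]; split.
  apply: (@eq_integrable _ _ _ _ setT measurableT
    ((EFin \o (fun z => (complex.Re (f z.1) * complex.Re (g z.2))%R)) \-
     (EFin \o (fun z => (complex.Im (f z.1) * complex.Im (g z.2))%R)))%E).
    by move=> z _ /=; case: (f z.1) (g z.2) => ? ? [].
  apply: integrableB => //; first exact: (integrable_tensor fr gr).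
  exact: (integrable_tensor fi gi).
apply: (@eq_integrable _ _ _ _ setT measurableT
  ((EFin \o (fun z => (complex.Re (f z.1) * complex.Im (g z.2))%R)) \+
   (EFin \o (fun z => (complex.Im (f z.1) * complex.Re (g z.2))%R)))%E).
  by move=> z _ /=; case: (f z.1) (g z.2) => ? ? [].
apply: integrableD => //; first exact: (integrable_tensor fr gi).
exact: (integrable_tensor fi gr).
Qed.

Lemma cintegral_tensor (R : realType) (d1 d2 : measure_display)
    (T1 : measurableType d1) (T2 : measurableType d2)
    (m1 : {sigma_finite_measure set T1 -> \bar R})
    (m2 : {sigma_finite_measure set T2 -> \bar R})
    (f : T1 -> R[i]) (g : T2 -> R[i]) :
  cintegrable m1 setT f -> cintegrable m2 setT g ->
  cintegral (m1 \x m2)%E setT (fun z => f z.1 * g z.2) =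
  cintegral m1 setT f * cintegral m2 setT g.
Proof.
move=> [fr fi] [gr gi]; rewrite /cintegral.
have -> : (fun z : T1 * T2 => complex.Re (f z.1 * g z.2)) =
    (fun z => complex.Re (f z.1) * complex.Re (g z.2) -
              complex.Im (f z.1) * complex.Im (g z.2)).
  by apply/funext => z; case: (f z.1) (g z.2) => ? ? [].
have -> : (fun z : T1 * T2 => complex.Im (f z.1 * g z.2)) =
    (fun z => complex.Re (f z.1) * complex.Im (g z.2) +
              complex.Im (f z.1) * complex.Re (g z.2)).
  by apply/funext => z; case: (f z.1) (g z.2) => ? ? [].
rewrite RintegralB//; last 2 first.
- exact: (integrable_tensor fr gr).
- exact: (integrable_tensor fi gi).
rewrite RintegralD//; last 2 first.
- exact: (integrable_tensor fr gi).
- exact: (integrable_tensor fi gr).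
rewrite (Rintegral_tensor fr gr) (Rintegral_tensor fi gi).
by rewrite (Rintegral_tensor fr gi) (Rintegral_tensor fi gr).
Qed.

(** * Product functions on cubes *)

(** Lebesgue measure on row vectors is the image of a binary product under
    rV_cons, so each coordinate costs one change of variables and one use of
    the tensor lemma. *)
Lemma cintegral_prod_rV (R : realType) (n : nat) (phi : 'I_n -> R -> R[i]) :
  (forall i, cintegrable (@lebesgue_measure R) setT (phi i)) ->
  cintegrable (lebesgue_rV n) setT (fun x : 'rV[R]_n => \prod_i phi i (x 0 i)) /\
  cintegral (lebesgue_rV n) setT (fun x : 'rV[R]_n => \prod_i phi i (x 0 i)) =
  \prod_i cintegral (@lebesgue_measure R) setT (phi i).
Proof.
elim: n phi => [phi _|n IH phi phiI].
  have prodE : (fun x : 'rV[R]_0 => \prod_i phi i (x 0 i)) = (fun=> 1).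
    by apply/funext => x; rewrite big_ord0.
  have cstI (r : R) : (\d_(0 : 'rV[R]_0)).-integrable setT (EFin \o cst r).
    by apply: finite_measure_integrable_cst.
  rewrite prodE big_ord0; split; first by split; exact: cstI.
  rewrite /cintegral /= !Rintegral_cst//=.
  by rewrite indicT /= mul0r mul1r.
pose F (z : R * 'rV[R]_n) := phi ord0 z.1 * \prod_i phi (lift ord0 i) (z.2 0 i).
have [gI gE] := IH (fun i => phi (lift ord0 i)) (fun i => phiI _).
have FI : cintegrable (lebesgue_measure \x lebesgue_rV n)%E setT F.
  exact: (cintegrable_tensor (phiI ord0) gI).
have prodE : (fun x : 'rV[R]_n.+1 => \prod_i phi i (x 0 i)) = F \o @rV_uncons R n.
  apply/funext => x; rewrite big_ord_recl /F /=; congr (_ * _).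
  by apply: eq_bigr => i _; rewrite mxE.
have comp_cons (h : R[i] -> R) : h \o (F \o @rV_uncons R n) \o @rV_cons R n = h \o F.
  by apply/funext => z /=; rewrite rV_consK.
have meas (h : R[i] -> R) :
    measurable_fun setT (EFin \o (h \o F)) ->
    measurable_fun setT (EFin \o (h \o (F \o @rV_uncons R n))).
  by move=> mh; exact: (measurableT_comp mh (@measurable_rV_uncons R n)).
have [FIr FIi] := FI.
have push (h : R[i] -> R) :
    (lebesgue_measure \x lebesgue_rV n)%E.-integrable setT (EFin \o (h \o F)) ->
    (lebesgue_rV n.+1).-integrable setT (EFin \o (h \o (F \o @rV_uncons R n))) /\
    (\int[lebesgue_rV n.+1]_x h (F (rV_uncons x)) =
     \int[(lebesgue_measure \x lebesgue_rV n)%E]_z h (F z)).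
  move=> hI; have mh := meas h (measurable_int _ hI).
  have hI' : (lebesgue_measure \x lebesgue_rV n)%E.-integrable
      (@rV_cons R n @^-1` setT)
      ((EFin \o (h \o (F \o @rV_uncons R n))) \o @rV_cons R n).
    by rewrite preimage_setT -compA comp_cons.
  split.
    apply: (integrable_pushforward _ mh hI' measurableT).
    exact: measurable_rV_cons.
  rewrite /Rintegral; congr fine.
  apply: etrans; first apply: (integral_pushforward _ mh hI' measurableT).
    exact: measurable_rV_cons.
  by rewrite preimage_setT -compA comp_cons.
have [Ir Er] := push (@complex.Re R) FIr; have [Ii Ei] := push (@complex.Im R) FIi.
rewrite prodE; split; first by split.
rewrite big_ord_recl -gE -(cintegral_tensor (phiI ord0) gI).
by rewrite /cintegral Er Ei.
Qed.

Definition box (R : realType) (n : nat) (A : set R) : set 'rV[R]_n :=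
  [set x | forall i, A (x 0 i)].

Lemma measurable_box (R : realType) (n : nat) (A : set R) :
  measurable A -> measurable (@box R n A).
Proof.
move=> mA.
have -> : @box R n A =
    \bigcap_(i in [set: 'I_n]) ((fun x => x 0 i) @^-1` A).
  by apply/seteqP; split => [x Ax i _|x Ax i]; exact: Ax.
apply: fin_bigcap_measurable; first exact: finite_finset.
by move=> i _; rewrite -[X in measurable X]setTI; exact: measurable_coord.
Qed.

Lemma patch_prod (R : realType) (n : nat) (A : set R) (phi : 'I_n -> R -> R[i]) :
  (fun x : 'rV[R]_n => \prod_i (patch (fun=> 0) A (phi i)) (x 0 i)) =
  patch (fun=> 0) (box A) (fun x => \prod_i phi i (x 0 i)).
Proof.
apply/funext => x; rewrite /patch; case: ifPn => [/set_mem xA|].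
  by apply: eq_bigr => i _; rewrite /patch mem_set//; exact: xA.
rewrite notin_setE => /existsNP [i xA].
by rewrite (bigD1 i)//= /patch memNset// mul0r.
Qed.

(** Extension by 0 commutes with taking real and imaginary parts. *)
Lemma cintegrable_mkcond (R : realType) (d : measure_display)
    (T : measurableType d) (mu : {measure set T -> \bar R}) (D : set T)
    (f : T -> R[i]) :
  measurable D -> cintegrable mu D f <-> cintegrable mu setT (patch (fun=> 0) D f).
Proof.
move=> mD; rewrite /cintegrable.
have E (h : R[i] -> R) : h 0 = 0 ->
    EFin \o (fun x => h (patch (fun=> 0) D f x)) = (EFin \o (fun x => h (f x))) \_ D.
  by move=> h0; apply/funext => x /=; rewrite !/patch; case: ifPn => //; rewrite h0.
by rewrite !E//; split=> -[a b]; split; apply/(integrable_mkcond _ mD).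
Qed.

Lemma cintegral_mkcond (R : realType) (d : measure_display)
    (T : measurableType d) (mu : {measure set T -> \bar R}) (D : set T)
    (f : T -> R[i]) :
  cintegral mu D f = cintegral mu setT (patch (fun=> 0) D f).
Proof.
rewrite /cintegral Rintegral_mkcond [in X in Complex _ X]Rintegral_mkcond.
by congr Complex; apply: eq_Rintegral => x _; rewrite !/patch; case: ifPn.
Qed.

(** A cube is a product set: extending each factor by 0 outside A extends the
    product by 0 outside the cube, which reduces to integrals over the whole
    space. *)
Lemma cintegral_box (R : realType) (n : nat) (A : set R) (phi : 'I_n -> R -> R[i]) :
  measurable A -> (forall i, cintegrable (@lebesgue_measure R) A (phi i)) ->
  cintegrable (lebesgue_rV n) (box A) (fun x => \prod_i phi i (x 0 i)) /\
  cintegral (lebesgue_rV n) (box A) (fun x => \prod_i phi i (x 0 i)) =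
  \prod_i cintegral (@lebesgue_measure R) A (phi i).
Proof.
move=> mA phiI.
have phiI' i : cintegrable (@lebesgue_measure R) setT (patch (fun=> 0) A (phi i)).
  exact: (cintegrable_mkcond (@lebesgue_measure R) _ mA).1.
have [pI pE] := cintegral_prod_rV phiI'.
split.
  by apply: (cintegrable_mkcond (lebesgue_rV n) _ (measurable_box mA)).2;
    rewrite -patch_prod.
rewrite cintegral_mkcond -patch_prod pE.
by apply: eq_bigr => i _; rewrite -cintegral_mkcond.
Qed.

(** * Integrals of characters *)

Lemma cintegrableD (R : realType) (d : measure_display) (T : measurableType d)
    (mu : {measure set T -> \bar R}) (D : set T) (f g : T -> R[i]) :
  measurable D -> cintegrable mu D f -> cintegrable mu D g ->
  cintegrable mu D (fun x => f x + g x).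
Proof.
move=> mD [fr fi] [gr gi]; split.
  apply: (eq_integrable mD _ _ _ (integrableD mD fr gr)) => x _ /=.
  by case: (f x) (g x) => ? ? [].
apply: (eq_integrable mD _ _ _ (integrableD mD fi gi)) => x _ /=.
by case: (f x) (g x) => ? ? [].
Qed.

Lemma cintegralD (R : realType) (d : measure_display) (T : measurableType d)
    (mu : {measure set T -> \bar R}) (D : set T) (f g : T -> R[i]) :
  measurable D -> cintegrable mu D f -> cintegrable mu D g ->
  cintegral mu D (fun x => f x + g x) = cintegral mu D f + cintegral mu D g.
Proof.
move=> mD [fr fi] [gr gi]; rewrite /cintegral.
transitivity (Complex (\int[mu]_(x in D) (complex.Re (f x) + complex.Re (g x)))
                      (\int[mu]_(x in D) (complex.Im (f x) + complex.Im (g x)))).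
  by congr Complex; apply: eq_Rintegral => x _; case: (f x) (g x) => ? ? [].
by rewrite !RintegralD.
Qed.

Lemma cintegral_sum (R : realType) (d : measure_display) (T : measurableType d)
    (mu : {measure set T -> \bar R}) (D : set T) (I : Type) (s : seq I)
    (F : I -> T -> R[i]) :
  measurable D -> (forall k, cintegrable mu D (F k)) ->
  cintegrable mu D (fun x => \sum_(k <- s) F k x) /\
  cintegral mu D (fun x => \sum_(k <- s) F k x) =
  \sum_(k <- s) cintegral mu D (F k).
Proof.
move=> mD FI; elim: s => [|k s [sI sE]].
  have -> : (fun x => \sum_(k <- [::]) F k x) = (fun=> 0).
    by apply/funext => x; rewrite big_nil.
  rewrite big_nil; split; first by split; exact: integrable0.
  by rewrite /cintegral /= !Rintegral_cst// mul0r.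
have -> : (fun x => \sum_(j <- k :: s) F j x) =
    (fun x => F k x + \sum_(j <- s) F j x).
  by apply/funext => x; rewrite big_cons.
by rewrite big_cons -sE cintegralD//; split=> //; exact: cintegrableD.
Qed.

Lemma expi0 (R : realType) : expi (0 : R) = 1.
Proof. by rewrite /expi cos0 sin0. Qed.

Lemma expiD (R : realType) (a b : R) : expi (a + b) = expi a * expi b.
Proof. by rewrite /expi cosD sinD; congr Complex; rewrite addrC. Qed.

Lemma expi_sum (R : realType) (I : Type) (r : seq I) (a : I -> R) :
  expi (\sum_(i <- r) a i) = \prod_(i <- r) expi (a i).
Proof. exact: (big_morph (@expi R) (@expiD R) (@expi0 R)). Qed.

(** Multiplying a sum of characters by 1 + 1 + e^(i th) + e^(-i th) keeps each
    frequency k twice and adds its two neighbours.  Frequencies are listed with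
    multiplicity, so that all coefficients are 1 and no sign has to be
    tracked. *)
Lemma cos_power_expi (R : realType) (N : nat) :
  exists s : seq int, forall th : R,
    ((2 + 2 * cos th) ^+ N)%:C%C = \sum_(k <- s) expi (k%:~R * th).
Proof.
elim: N => [|N [s sE]].
  by exists [:: 0] => th; rewrite big_seq1 mul0r expi0 expr0.
exists (s ++ s ++ map (fun k => k + 1) s ++ map (fun k => k - 1) s) => th.
rewrite !big_cat !big_map /= exprS rmorphM /= sE.
have -> : (2 + 2 * cos th)%:C%C = 1 + (1 + (expi th + expi (- th))).
  rewrite /expi cosN sinN; apply/eqP; rewrite eq_complex /=.
  by apply/andP; split; apply/eqP; ring.
rewrite !mulrDl !mul1r !mulr_sumr; congr (_ + (_ + (_ + _))).
  by apply: eq_bigr => k _; rewrite -expiD intrD; congr expi; ring.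
by apply: eq_bigr => k _; rewrite -expiD intrD mulrN1z; congr expi; ring.
Qed.

Lemma sin_intpi (R : realType) (k : int) : sin (k%:~R * pi : R) = 0.
Proof.
have natE (n : nat) : sin (n%:R * pi : R) = 0.
  elim: n => [|n IH]; first by rewrite mul0r sin0.
  by rewrite -natr1 mulrDl mul1r sinDpi IH oppr0.
by case: k => n; [rewrite natE | rewrite NegzE intrN mulNr sinN natE oppr0].
Qed.

Lemma continuous_scale (R : realType) (f : R -> R) (w : R) :
  continuous f -> continuous (fun t => f (w * t)).
Proof.
move=> cf t.
by apply: continuous_comp; [exact: mulrl_continuous | exact: cf].
Qed.

Lemma continuous_integrable_itv (R : realType) (f : R -> R) (a : R) :
  continuous f -> (@lebesgue_measure R).-integrable `[- a, a[ (EFin \o f).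
Proof.
move=> cf.
have cI : (@lebesgue_measure R).-integrable `[- a, a] (EFin \o f).
  apply: continuous_compact_integrable; first exact: segment_compact.
  exact: continuous_subspaceT.
by apply: integrableS cI => //; apply: subset_itvl; rewrite bnd_simp.
Qed.

(** The intervals are half-open because the torus is; the endpoint is a null
    set, so the fundamental theorem of calculus on the closed interval
    applies. *)
Lemma Rintegral_itv_derive (R : realType) (f F : R -> R) (a : R) :
  0 < a -> continuous f -> (forall t, is_derive t (1 : R) F (f t)) ->
  \int[@lebesgue_measure R]_(t in `[- a, a[) f t = F a - F (- a).
Proof.
move=> a0 cf dF; have ltNa : - a < a by rewrite (lt_trans _ a0)// oppr_lt0.
have cF : continuous F.
  by move=> t; apply/differentiable_continuous/derivable1_diffP; have [] := dF t.
rewrite Rintegral_itv_bndo_bndc; last exact: continuous_integrable_itv.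
rewrite /Rintegral (@continuous_FTC2 _ f F)//.
- exact: continuous_subspaceT.
- split=> [t _||]; first by have [] := dF t.
    exact: cvg_at_right_filter (cF _).
  exact: cvg_at_left_filter (cF _).
- by move=> t _; rewrite derive1E; have [_ ->] := dF t.
Qed.

Lemma Rintegral_cst_itv (R : realType) (a r : R) : 0 < a ->
  \int[@lebesgue_measure R]_(t in `[- a, a[) r = r * (2 * a).
Proof.
move=> a0.
have dF t : is_derive t (1 : R) (fun t => r * t) r.
  by apply: is_derive_eq; rewrite /GRing.scale /= mulr1.
rewrite (Rintegral_itv_derive a0 _ dF); first by ring.
exact: cst_continuous.
Qed.

Lemma cintegrable_expi (R : realType) (a w : R) :
  cintegrable (@lebesgue_measure R) `[- a, a[ (fun t => expi (w * t)).
Proof.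
by split; apply: continuous_integrable_itv; apply: continuous_scale;
  [exact: continuous_cos | exact: continuous_sin].
Qed.

(** For k != 0 both antiderivatives take the same value at a and - a: the cosine
    because it is even, the sine because its argument is a multiple of pi
    there. *)
Lemma cintegral_expi (R : realType) (a : R) (k : int) : 0 < a ->
  cintegral (@lebesgue_measure R) `[- a, a[
    (fun t => expi (k%:~R * (pi / a) * t)) = ((2 * a) *+ (k == 0))%:C%C.
Proof.
move=> a0; rewrite /cintegral /=.
have [->|k0] := eqVneq k 0.
  congr Complex.
    by under eq_Rintegral do rewrite !mul0r cos0; rewrite Rintegral_cst_itv// mul1r.
  by under eq_Rintegral do rewrite !mul0r sin0; rewrite Rintegral_cst_itv// mul0r.
set w := k%:~R * (pi / a).
have w0 : w != 0.
  by rewrite !mulf_neq0 ?invr_eq0 ?intr_eq0// gt_eqF ?pi_gt0.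
have waE : w * a = k%:~R * pi by rewrite /w; field; rewrite gt_eqF.
have dsin t : is_derive t (1 : R) (fun t => w^-1 * sin (w * t)) (cos (w * t)).
  by apply: is_derive_eq; rewrite /GRing.scale /=; field.
have dcos t :
    is_derive t (1 : R) (fun t => - (w^-1 * cos (w * t))) (sin (w * t)).
  by apply: is_derive_eq; rewrite /GRing.scale /=; field.
congr Complex.
  rewrite (Rintegral_itv_derive a0 _ dsin).
    by rewrite mulrN sinN waE sin_intpi mulrN mulr0 oppr0 subr0.
  exact: continuous_scale (@continuous_cos R).
rewrite (Rintegral_itv_derive a0 _ dcos).
  by rewrite mulrN cosN subrr.
exact: continuous_scale (@continuous_sin R).
Qed.

(** * One-dimensional peaks *)

(** The maximum 4 ^ N is attained exactly at the multiples of 1 / q when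
    N and q are positive. *)
Definition spikes (R : realType) (q N : nat) (t : R) : R :=
  (2 + 2 * cos (2 * pi * q%:R * t)) ^+ N.

Lemma spikes_base_ge0 (R : realType) (x : R) : 0 <= 2 + 2 * cos x.
Proof. by have := cos_geN1 x; lra. Qed.

Lemma spikes_ge0 (R : realType) (q N : nat) (t : R) : 0 <= spikes q N t.
Proof. exact/exprn_ge0/spikes_base_ge0. Qed.

Lemma continuous_spikes (R : realType) (q N : nat) : continuous (@spikes R q N).
Proof.
have cc : continuous (fun t : R => 2 + 2 * cos (2 * pi * q%:R * t)).
  move=> t; apply: cvgD; first exact: cvg_cst.
  apply: cvgM; first exact: cvg_cst.
  exact: (continuous_scale (@continuous_cos R)).
by move=> t; exact: (continuous_comp (cc t) (@exprn_continuous _ N _)).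
Qed.

(** After expansion, the integral counts the frequencies k of the expansion with
    q k = m. *)
Lemma cintegral_spikes_char_ge0 (R : realType) (q N : nat) (m : int) :
  cintegrable (@lebesgue_measure R) `[- 2^-1, 2^-1[
    (fun t => (spikes q N t)%:C%C * expi (- (2 * pi * (m%:~R * t)))) /\
  0 <= cintegral (@lebesgue_measure R) `[- 2^-1, 2^-1[
    (fun t => (spikes q N t)%:C%C * expi (- (2 * pi * (m%:~R * t)))).
Proof.
have [s sE] := cos_power_expi R N.
have -> : (fun t => (spikes q N t)%:C%C * expi (- (2 * pi * (m%:~R * t)))) =
    (fun t : R => \sum_(k <- s) expi ((q%:Z * k - m)%:~R * (pi / 2^-1) * t)).
  apply/funext => t; rewrite /spikes sE mulr_suml; apply: eq_bigr => k _.
  rewrite -expiD; congr expi; rewrite intrB intrM invrK.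
  by rewrite -pmulrn; ring.
have [sI ->] := @cintegral_sum R _ _ (@lebesgue_measure R) `[- 2^-1, 2^-1[%classic
  _ s (fun k t => expi ((q%:Z * k - m)%:~R * (pi / 2^-1) * t))
  (measurable_itv _) (fun k => cintegrable_expi _ _).
split=> //; apply: sumr_ge0 => k _.
by rewrite cintegral_expi ?invr_gt0// ler0c mulrn_wge0// mulr_ge0.
Qed.

(** The nonconstant characters of the expansion have mean zero over the central
    period as well as over the torus, so both integrals are the multiplicity of
    the frequency 0 times the length of the interval. *)
Lemma Rintegral_spikes_period (R : realType) (q N : nat) : (0 < q)%N ->
  \int[@lebesgue_measure R]_(t in `[- (2 * q%:R)^-1, (2 * q%:R)^-1[) spikes q N t =
  q%:R^-1 * \int[@lebesgue_measure R]_(t in `[- 2^-1, 2^-1[) spikes q N t.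
Proof.
move=> q0; have [s sE] := cos_power_expi R N.
have q0R : q%:R != 0 :> R by rewrite pnatr_eq0 -lt0n.
(* On [-a, a) with 2 q = c / a, the expansion involves only multiples of the
   fundamental frequency pi / a.  The central period is the case c = 1, the
   torus the case c = q. *)
pose mean a := cintegral (@lebesgue_measure R) `[- a, a[
  (fun t => (spikes q N t)%:C%C).
have meanE a (c : int) : 0 < a -> c != 0 -> 2 * q%:R = c%:~R / a :> R ->
    mean a = \sum_(k <- s) ((2 * a) *+ (k == 0))%:C%C.
  move=> a0 c0 caE; rewrite /mean.
  have -> : (fun t => (spikes q N t)%:C%C) =
      (fun t : R => \sum_(k <- s) expi ((c * k)%:~R * (pi / a) * t)).
    apply/funext => t; rewrite /spikes sE; apply: eq_bigr => k _; congr expi.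
    have -> : 2 * pi * q%:R * t = pi * t * (2 * q%:R) by ring.
    rewrite caE intrM; field; by rewrite gt_eqF.
  have [_ ->] := @cintegral_sum R _ _ (@lebesgue_measure R) `[- a, a[%classic
    _ s (fun k t => expi ((c * k)%:~R * (pi / a) * t))
    (measurable_itv _) (fun k => cintegrable_expi _ _).
  by apply: eq_bigr => k _; rewrite cintegral_expi// mulf_eq0 (negPf c0).
have ReE a : complex.Re (mean a) =
    \int[@lebesgue_measure R]_(t in `[- a, a[) spikes q N t by [].
rewrite -!ReE (meanE _ 1)//; last 2 first.
- by rewrite invr_gt0 mulr_gt0// ltr0n.
- by rewrite mulr1z; field.
rewrite (meanE _ q%:Z)//; last 2 first.
- by rewrite -lt0n.
- by rewrite -pmulrn; field.
rewrite !raddf_sum /= mulr_sumr; apply: eq_bigr => k _ /=.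
by case: (k == 0); rewrite ?mulr1n ?mulr0n ?mulr0//; field.
Qed.

Lemma cos_le_itv (R : realType) (x y : R) :
  0 <= x -> x <= y -> y <= pi -> cos y <= cos x.
Proof.
move=> x0 xy ypi; rewrite leNgt ltr_cos -?leNgt// in_itv/=;
  by apply/andP; split=> //; lra.
Qed.

(** With al = 2 pi (1 - q d), the distance from 2 pi q d to the next peak at
    2 pi, the base is at most 2 + 2 cos al between the central period and the
    boundary of [-d, d], and at least 2 + 2 cos (al / 2) within
    eta = (1 - q d) / (2 q) of the origin; the cosine decreases strictly on
    [0, pi]. *)
Lemma spikes_separation (R : realType) (q : nat) (d : R) :
  (0 < q)%N -> (2 * q%:R)^-1 <= d -> d < q%:R^-1 ->
  exists eta c0 c1 : R,
  [/\ 0 < eta <= 2^-1, 0 <= c0 < c1,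
      forall t, `|t| <= eta -> c1 <= 2 + 2 * cos (2 * pi * q%:R * t) &
      forall t, (2 * q%:R)^-1 <= `|t| <= d -> 2 + 2 * cos (2 * pi * q%:R * t) <= c0].
Proof.
move=> q0 dge dlt.
have q1 : 1 <= q%:R :> R by rewrite ler1n.
have qV : (2 * q%:R)^-1 * q%:R = 2^-1 :> R by field; lra.
have qd1 : q%:R * d < 1 by rewrite -ltr_pdivlMl ?mulr1//; lra.
have qd2 : 2^-1 <= q%:R * d by rewrite -qV mulrC ler_pM2l//; lra.
have pi0 := pi_gt0 R.
pose al : R := 2 * pi * (1 - q%:R * d).
have al0 : 0 < al by rewrite /al mulr_gt0//; [rewrite mulr_gt0 | lra].
have alpi : al <= pi.
  by rewrite /al -[leRHS]mulr1 -mulrA mulrCA ler_pM2l//; lra.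
have qE (t : R) : cos (2 * pi * q%:R * t) = cos (2 * pi * q%:R * `|t|).
  by rewrite -cos_norm normrM ger0_norm// !mulr_ge0//; lra.
exists ((1 - q%:R * d) / (2 * q%:R)), (2 + 2 * cos al), (2 + 2 * cos (al / 2)).
split.
- apply/andP; split; first by rewrite divr_gt0//; lra.
  by rewrite ler_pdivrMr; lra.
- rewrite spikes_base_ge0 ltrD2l ltr_pM2l// ltr_cos ?in_itv/=; first by lra.
    by apply/andP; split; lra.
  by apply/andP; split; lra.
- move=> t tle; rewrite qE lerD2l ler_pM2l//; apply: cos_le_itv; last by lra.
    by rewrite !mulr_ge0//; lra.
  have -> : al / 2 = 2 * pi * q%:R * ((1 - q%:R * d) / (2 * q%:R)).
    by rewrite /al; field; lra.
  by rewrite ler_pM2l// mulr_gt0//; lra.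
- move=> t /andP[tge tle]; rewrite qE lerD2l ler_pM2l//.
  (* The argument lies in [pi, 2 pi); it is reflected into [0, pi], where the
     cosine is monotone. *)
  have -> : cos (2 * pi * q%:R * `|t|) = cos (2 * pi * (1 - q%:R * `|t|)).
    rewrite -cosN -cosD2pi; congr cos; rewrite mulr2n; ring.
  have t1 : 2^-1 <= q%:R * `|t| by rewrite -qV mulrC ler_pM2l//; lra.
  have t2 : q%:R * `|t| <= q%:R * d by rewrite ler_pM2l//; lra.
  apply: cos_le_itv; first by lra.
    by rewrite /al ler_pM2l ?mulr_gt0//; lra.
  by rewrite -[leRHS]mulr1 -mulrA mulrCA ler_pM2l//; lra.
Qed.

Lemma integrable_spikes (R : realType) (q N : nat) (a : R) :
  (@lebesgue_measure R).-integrable `[- a, a[ (EFin \o spikes q N).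
Proof. exact/continuous_integrable_itv/continuous_spikes. Qed.

Lemma ler_itv_Rintegral (R : realType) (f : R -> R) (a b : R) :
  a <= b -> continuous f -> (forall t, 0 <= f t) ->
  \int[@lebesgue_measure R]_(t in `[- a, a[) f t <=
  \int[@lebesgue_measure R]_(t in `[- b, b[) f t.
Proof.
move=> ab cf f0; have fI c := continuous_integrable_itv c cf.
rewrite /Rintegral fine_le//; try exact: integrable_fin_num.
apply: ge0_subset_integral => //.
- by have /integrableP[] := fI b.
- by move=> t _; rewrite lee_fin.
- by apply: subset_itv; rewrite bnd_simp// lerN2.
Qed.

(** The part of the integral over [-d, d) outside the central period is at most
    2 d c0^M and the integral over the torus at least 2 eta c1^M with c0 < c1,
    so their quotient tends to 0.  The exponent is doubled because spikes q N
    is squared in the L2 norm. *)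
Lemma spikes_concentrate (R : realType) (q : nat) (d eps : R) :
  (0 < q)%N -> (2 * q%:R)^-1 <= d -> d < q%:R^-1 -> 0 < eps ->
  exists N : nat,
    0 < \int[@lebesgue_measure R]_(t in `[- 2^-1, 2^-1[) spikes q N.*2 t /\
    \int[@lebesgue_measure R]_(t in `[- d, d[) spikes q N.*2 t <=
    (q%:R^-1 + eps) *
      \int[@lebesgue_measure R]_(t in `[- 2^-1, 2^-1[) spikes q N.*2 t.
Proof.
move=> q0 dge dlt eps0.
have [eta [c0 [c1 [/andP[eta0 etale] /andP[c00 c01] near0 far]]]] :=
  spikes_separation q0 dge dlt.
have c10 : 0 < c1 by exact: le_lt_trans c01.
have d0 : 0 < d by apply: lt_le_trans dge; rewrite invr_gt0 mulr_gt0// ltr0n.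
have lower M : 2 * eta * c1 ^+ M <=
    \int[@lebesgue_measure R]_(t in `[- 2^-1, 2^-1[) spikes q M t.
  apply: le_trans
    (ler_itv_Rintegral etale (@continuous_spikes R q M) (@spikes_ge0 R q M)).
  rewrite mulrC -Rintegral_cst_itv//; apply: le_Rintegral => //.
  - exact/continuous_integrable_itv/cst_continuous.
  - exact: integrable_spikes.
  - move=> t /=; rewrite in_itv/= => /andP[t1 t2].
    rewrite /spikes lerXn2r ?nnegrE ?spikes_base_ge0 ?(ltW c10)//.
    by apply: near0; rewrite ler_norml t1 ltW.
have upper : forall M, \int[@lebesgue_measure R]_(t in `[- d, d[) spikes q M t <=
    \int[@lebesgue_measure R]_(t in `[- (2 * q%:R)^-1, (2 * q%:R)^-1[) spikes q M t
    + c0 ^+ M * (2 * d).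
  move=> M; set P := `[- (2 * q%:R)^-1, (2 * q%:R)^-1[%classic.
  have PI : (@lebesgue_measure R).-integrable `[- d, d[ (EFin \o (spikes q M \_ P)).
    rewrite -restrict_EFin; apply: (@integrableS _ _ _ _ setT) => //.
    apply: (integrable_mkcond _ _).1; first exact: measurable_itv.
    exact: (integrable_spikes q M (2 * q%:R)^-1).
  have cI : (@lebesgue_measure R).-integrable `[- d, d[ (EFin \o cst (c0 ^+ M)).
    exact/continuous_integrable_itv/cst_continuous.
  apply: (@le_trans _ _ (\int[@lebesgue_measure R]_(t in `[- d, d[)
      ((spikes q M \_ P) t + c0 ^+ M))).
    apply: le_Rintegral => //; first exact: integrable_spikes.
      by apply: (eq_integrable _ _ _ _ (integrableD _ PI cI)).
    move=> t /=; rewrite in_itv/= => /andP[t1 t2]; rewrite patchE.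
    case: ifPn => [_|]; first by rewrite lerDl exprn_ge0.
    rewrite notin_setE /P /= in_itv /= => tP; rewrite add0r.
    rewrite /spikes lerXn2r ?nnegrE ?spikes_base_ge0//; apply: far.
    rewrite [X in _ && X]ler_norml t1 (ltW t2) !andbT leNgt; apply/negP => tlt.
    by apply: tP; move: tlt; rewrite ltr_norml => /andP[/ltW -> ->].
  rewrite RintegralD// Rintegral_cst_itv// -Rintegral_mkcondr setIidr//.
  by apply: subset_itv; rewrite bnd_simp// lerN2.
have r01 : `|c0 / c1| < 1.
  by rewrite ger0_norm ?divr_ge0 ?(ltW c10)// ltr_pdivrMr// mul1r.
(* This tolerance makes d / eta * (c0 / c1)^M at most eps. *)
have /cvgrPdist_le /(_ (eps * eta / d)) := cvg_expr r01.
have e'0 : 0 < eps * eta / d by rewrite divr_gt0// mulr_gt0.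
move=> /(_ e'0) [N _ /(_ N.*2)]; rewrite /= -addnn leq_addr addnn => /(_ isT).
rewrite sub0r normrN ger0_norm ?exprn_ge0 ?divr_ge0 ?(ltW c10)// => small.
exists N; split.
  by apply: lt_le_trans (lower _); rewrite !mulr_gt0// exprn_gt0.
apply: le_trans (upper _) _; rewrite Rintegral_spikes_period// [leRHS]mulrDl lerD2l.
apply: le_trans (ler_wpM2l (ltW eps0) (lower _)).
move: small; rewrite expr_div_n ler_pdivrMr ?exprn_gt0// => small.
have -> : eps * (2 * eta * c1 ^+ N.*2) = (eps * eta / d * c1 ^+ N.*2) * (2 * d).
  by field; rewrite gt_eqF.
by rewrite ler_pM2r// mulr_gt0.
Qed.

(** * The test function and the Wiener quotient *)

(** The integral of a nonnegative function is the supremum of the integrals of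
    the simple functions below its extension by 0, and this family grows with
    an arbitrary domain. *)
Lemma ge0_integral_subset (R : realType) (d : measure_display)
    (T : measurableType d) (mu : {measure set T -> \bar R}) (A B : set T)
    (f : T -> \bar R) :
  A `<=` B -> (forall x, 0 <= f x)%E ->
  (\int[mu]_(x in A) f x <= \int[mu]_(x in B) f x)%E.
Proof.
move=> AB f0; rewrite !ge0_integralE//.
apply: le_ereal_sup => _ /= [h hf <-]; exists h => // x; apply: le_trans (hf x) _.
rewrite !patchE; case: ifPn => [/set_mem/AB xB|_]; first by rewrite mem_set.
by case: ifPn.
Qed.

(** With x the volume of D, t and S the squares of the L2 norms over the torus
    and over D, this bounds the quotient from below through the conventions of
    the extended reals: both x = +oo and S = 0 make the denominator 0 and the
    quotient +oo, while x = 0 makes the left-hand side 0. *)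
Lemma le_wiener_quotient (R : realType) (x S : \bar R) (k t : R) :
  (0 <= x)%E -> (0 <= S)%E -> 0 < k -> 0 < t -> (S <= (k * t)%:E)%E ->
  (x * (k^-1)%:E <= t%:E / (x^-1 * S))%E.
Proof.
move=> x0 S0 k0 t0 St; case: x x0 => [r| |] // r0; last first.
  by rewrite invey mul0e inve0 gt0_muley ?lte_fin// leey.
have [->|rn0] := eqVneq r 0.
  by rewrite mul0e mule_ge0 ?lee_fin ?(ltW t0)// inve_ge0 mule_ge0// inve_ge0.
case: S S0 St => [s| |] // s0 st.
have {r0}r0 : 0 < r by rewrite lt_neqAle eq_sym rn0 -lee_fin.
rewrite [in X in (X * s%:E)%E]inver (negPf rn0) -EFinM inver.
have [->|sn0] := eqVneq s 0.
  by rewrite mulr0 eqxx gt0_muley ?lte_fin// leey.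
have {s0}s0 : 0 < s by rewrite lt_neqAle eq_sym sn0 -lee_fin.
rewrite ifF; last by rewrite mulf_eq0 invr_eq0 (negPf rn0) (negPf sn0).
rewrite -!EFinM lee_fin.
have -> : t * (r^-1 * s)^-1 = r * t / s by field; rewrite rn0 sn0.
by rewrite ler_pdivlMr// mulrAC ler_pdivrMr// -mulrA ler_pM2l// mulrC -lee_fin.
Qed.

Lemma torus_box (R : realType) (n : nat) :
  @torus R n = box `[- 2^-1, 2^-1[.
Proof.
by apply/seteqP; split => x xT i; have := xT i; rewrite /= in_itv.
Qed.

Definition spike_array (R : realType) (n q N : nat) (x : 'rV[R]_n) : R[i] :=
  \prod_(i < n) (spikes q N (x 0 i))%:C%C.

Lemma spike_array_L1plus (R : realType) (n q N : nat) :
  L1plus (@spike_array R n q N).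
Proof.
split.
  rewrite torus_box.
  have [] := @cintegral_box R n `[- 2^-1, 2^-1[%classic
    (fun _ t => (spikes q N t)%:C%C) (measurable_itv _) _ => //.
  move=> _; split; first exact: integrable_spikes.
  exact/continuous_integrable_itv/cst_continuous.
move=> nu.
pose phi (i : 'I_n) (t : R) :=
  (spikes q N t)%:C%C * expi (- (2 * pi * ((nu 0 i)%:~R * t))).
have fE : (fun x : 'rV[R]_n => spike_array q N x *
      expi (- (2 * pi * \sum_i (nu 0 i)%:~R * x 0 i))) =
    (fun x : 'rV[R]_n => \prod_i phi i (x 0 i)).
  apply/funext => x.
  by rewrite /spike_array mulr_sumr -sumrN expi_sum -big_split.
rewrite /fourier fE.
have [_] := @cintegral_box R n `[- 2^-1, 2^-1[%classic phi (measurable_itv _)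
  (fun i => (cintegral_spikes_char_ge0 R q N (nu 0 i)).1).
rewrite -torus_box /cintegral /integralC => ->.
by apply: prodr_ge0 => i _; exact: (cintegral_spikes_char_ge0 R q N (nu 0 i)).2.
Qed.

(** The right-hand side is written as the real part of a complex product so that
    cintegral_box applies to it. *)
Lemma normc_spike_array (R : realType) (n q N : nat) (x : 'rV[R]_n) :
  ComplexField.Normc.normc (spike_array q N x) ^+ 2 =
  complex.Re (\prod_(i < n) (spikes q N.*2 (x 0 i))%:C%C).
Proof.
rewrite /spike_array -!rmorph_prod /= expr0n /= addr0 sqr_sqrtr ?sqr_ge0//.
rewrite -prodrXl; apply: eq_bigr => i _.
by rewrite /spikes -exprM muln2.
Qed.

Lemma normL2sq_spike_array (R : realType) (n q N : nat) (a : R) :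
  (lebesgue_rV n).-integrable (box `[- a, a[)
    (fun x : 'rV[R]_n => (ComplexField.Normc.normc (spike_array q N x) ^+ 2)%:E) /\
  normL2sq (box `[- a, a[) (@spike_array R n q N) =
  ((\int[@lebesgue_measure R]_(t in `[- a, a[) spikes q N.*2 t) ^+ n)%:E.
Proof.
have [|[fI _] fE] := @cintegral_box R n `[- a, a[%classic
    (fun _ t => (spikes q N.*2 t)%:C%C) (measurable_itv _) _.
  move=> _; split; first exact: integrable_spikes.
  exact/continuous_integrable_itv/cst_continuous.
have -> : (fun x : 'rV[R]_n =>
      (ComplexField.Normc.normc (spike_array q N x) ^+ 2)%:E) =
    EFin \o (fun x => complex.Re (\prod_(i < n) (spikes q N.*2 (x 0 i))%:C%C)).
  by apply/funext => x /=; rewrite normc_spike_array.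
split=> //; rewrite /normL2sq.
under eq_integral do rewrite normc_spike_array.
rewrite -[LHS]fineK; last first.
  exact: (integrable_fin_num (measurable_box (measurable_itv _)) fI).
have := congr1 (@complex.Re R) fE; rewrite {1}/cintegral /= /Rintegral /= => ->.
congr EFin.
have -> : cintegral (@lebesgue_measure R) `[- a, a[
      (fun t => (spikes q N.*2 t)%:C%C) =
    (\int[@lebesgue_measure R]_(t in `[- a, a[) spikes q N.*2 t)%:C%C.
  by rewrite /cintegral /= Rintegral_cst// mul0r.
by rewrite -rmorph_prod prodr_const card_ord.
Qed.

Lemma spike_array_not_ae0 (R : realType) (n q N : nat) :
  0 < \int[@lebesgue_measure R]_(t in `[- 2^-1, 2^-1[) spikes q N.*2 t ->
  ~ {ae lebesgue_rV n, forall x, @torus R n x -> spike_array q N x = 0}.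
Proof.
move=> c0 ae0; have [fI fE] := normL2sq_spike_array n q N (2^-1 : R).
have : normL2sq (box `[- 2^-1, 2^-1[) (@spike_array R n q N) = 0%E.
  rewrite /normL2sq (@ae_eq_integral _ _ _ _ _ (cst 0%E)) ?integral0//.
  - exact: measurable_box (measurable_itv _).
  - exact: measurable_int fI.
  - apply: filterS ae0 => x f0 xB /=.
    by rewrite f0 ?torus_box// ComplexField.Normc.normc0 expr0n.
by rewrite fE => -[] /eqP; rewrite gt_eqF// exprn_gt0.
Qed.

Lemma wiener_ge_approx (R : realType) (n q : nat) (d eps : R) (D : set 'rV[R]_n) :
  (0 < q)%N -> (2 * q%:R)^-1 <= d -> d < q%:R^-1 -> 0 < eps ->
  D `<=` box `[- d, d[ ->
  (lebesgue_rV n D * (((q%:R^-1 + eps) ^+ n)^-1)%:E <= wiener D)%E.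
Proof.
move=> q0 dge dlt eps0 DB.
have [N [c0 cN]] := spikes_concentrate q0 dge dlt eps0.
have [_ torusE] := normL2sq_spike_array n q N (2^-1 : R).
have [_ boxE] := normL2sq_spike_array n q N d.
have sq_ge0 (x : 'rV[R]_n) :
    (0 <= (ComplexField.Normc.normc (spike_array q N x) ^+ 2)%:E)%E.
  by rewrite lee_fin sqr_ge0.
have DE : (normL2sq D (@spike_array R n q N) <=
    ((\int[@lebesgue_measure R]_(t in `[- d, d[) spikes q N.*2 t) ^+ n)%:E)%E.
  by rewrite -boxE; exact: ge0_integral_subset.
have quotient_ge : (lebesgue_rV n D * (((q%:R^-1 + eps) ^+ n)^-1)%:E <=
    normL2sq (@torus R n) (spike_array q N) /
    ((lebesgue_rV n D)^-1 * normL2sq D (spike_array q N)))%E.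
  rewrite torus_box torusE; apply: le_wiener_quotient => //.
  - exact: integral_ge0.
  - by rewrite exprn_gt0// addr_gt0// invr_gt0 ltr0n.
  - by rewrite exprn_gt0.
  - apply: le_trans DE _; rewrite lee_fin -exprMn lerXn2r ?nnegrE//.
      by apply: Rintegral_ge0 => t _; exact: spikes_ge0.
    by rewrite mulr_ge0 ?(ltW c0)// addr_ge0 ?(ltW eps0)// invr_ge0.
apply: le_trans quotient_ge _.
apply: ereal_sup_ubound; exists (@spike_array R n q N) => //=; split.
- exact: spike_array_L1plus.
- exact: spike_array_not_ae0.
- by apply: le_lt_trans DE _; rewrite ltry.
Qed.

Unset Implicit Arguments.

Theorem theorem4 (R : realType) (n q : nat) (hq : (2 <= q)%N)
    (delta : R) (hdelta0 : 0 < delta) (hdeltaq : delta < q%:R^-1)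
    (D : set 'rV[R]_n) (hD : symmetric_convex_body D)
    (hDdelta : D `<=` [set delta *: x |
      x in [set x : 'rV[R]_n | forall i, -1 <= x 0 i <= 1]]) :
  (lebesgue_rV n D * (q%:R ^+ n)%:E <= wiener D)%E.
Proof.
have q0 : (0 < q)%N by exact: ltnW.
have q0R : 0 < q%:R :> R by rewrite ltr0n.
(* d lies strictly between delta and 1 / q, so that the half-open cube
   [-d, d)^n contains D, and it is at least the half-period 1 / (2 q). *)
pose d := (Num.max delta (2 * q%:R)^-1 + q%:R^-1) / 2.
have maxlt : Num.max delta (2 * q%:R)^-1 < q%:R^-1.
  by rewrite gt_max hdeltaq ltf_pV2 ?posrE ?mulr_gt0//; lra.
have dlt : d < q%:R^-1 by rewrite /d; lra.
have maxd : Num.max delta (2 * q%:R)^-1 < d by rewrite /d; lra.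
move: maxd; rewrite gt_max => /andP[deltad /ltW dge].
have DB : D `<=` box `[- d, d[.
  move=> _ /hDdelta [x xI <-] i /=; rewrite in_itv/= mxE.
  have /andP[x1 x2] := xI i.
  by apply/andP; split; nra.
(* It is enough to reach any fraction rho < 1 of the bound; eps is then chosen
   by continuity of (1 / q + eps)^n at eps = 0. *)
apply/lee_mul01Pr; first by rewrite mule_ge0// lee_fin exprn_ge0// ltW.
move=> rho /andP[rho0 rho1].
have [eps eps0 epsE] :
    exists2 eps : R, 0 < eps & (q%:R^-1 + eps) ^+ n < (rho * q%:R ^+ n)^-1.
  have cvgE : (fun e : R => (q%:R^-1 + e) ^+ n) @ 0^'+ --> ((q%:R^-1 + 0) ^+ n : R).
    have addC : continuous (fun e : R => q%:R^-1 + e).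
      by move=> e; apply: cvgD; [exact: cvg_cst | exact: cvg_id].
    exact: cvg_at_right_filter
      (continuous_comp (addC 0) (@exprn_continuous _ n _)).
  have ltE : (q%:R^-1 + 0) ^+ n < (rho * q%:R ^+ n)^-1.
    rewrite addr0 exprVn ltf_pV2 ?posrE ?mulr_gt0 ?exprn_gt0//.
    by rewrite gtr_pMl// exprn_gt0.
  near (0 : R)^'+ => e; exists e => //.
  by near: e; apply: cvgr_lt cvgE _ ltE.
apply: le_trans (wiener_ge_approx q0 dge dlt eps0 DB).
rewrite muleCA lee_wpmul2l// -EFinM lee_fin -[leLHS]invrK lef_pV2 ?posrE.
- exact: ltW.
- by rewrite invr_gt0 mulr_gt0// exprn_gt0.
- by rewrite exprn_gt0// addr_gt0// invr_gt0.
Unshelve. all: by end_near.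
Qed.
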